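(* Let $k\ge1$ be an integer and let $g$ be the probability density on $(0,\infty)$ of the distance between two independent uniformly random points of a bounded region of $k$-dimensional Euclidean space, with $g(t)\sim \frac{k\,\pi^{k/2}}{\Gamma(k/2+1)}t^{k-1}$ as $t\downarrow0$. Let $\tilde G(s)=\int_0^\infty e^{-st}g(t)\,dt$, $h(s)=-\tilde G'(s)/\tilde G(s)$ for $s\ge 0$, and $d_{\max}=\int_0^\infty t\,g(t)\,dt$. Then $h$ is continuous, positive and strictly decreasing on $[0,\infty)$, with $h(0)=d_{\max}$ and $h(s)\to0$ as $s\to\infty$. Hence for every $\bar d\in(0,d_{\max}]$ the maximum likelihood equation $$\frac{\tilde G'(s)}{\tilde G(s)}=-\bar d$$ has a unique solution $s\in[0,\infty)$, while for $\bar d>d_{\max}$ it has no solution $s\in[0,\infty)$.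
   Context: The equation arises as the likelihood equation for the parameter $s$ of a Waxman random graph (nodes uniformly random in the region; each pair at distance $d$ linked independently with probability $q e^{-sd}$), with $\bar d$ the observed mean edge length. The small-$t$ behaviour of $g$ is the paper's approximation that boundary effects are negligible at small distances (region normalised to unit volume). *)

(* Defs.v *)
From HB Require Import structures.
From mathcomp Require Export all_boot all_order all_algebra.
From mathcomp Require Export all_classical all_reals all_analysis.
Export Order.TTheory GRing.Theory Num.Theory.
Export numFieldNormedType.Exports.

Set Implicit Arguments.
Unset Strict Implicit.
Unset Printing Implicit Defensive.

Local Open Scope classical_set_scope.
Local Open Scope ring_scope.

Definition pos_reals (R : realType) : set R := `]0, +oo[.
Arguments pos_reals R : clear implicits.

(* Points of k-dimensional Euclidean space are k-tuples of reals: this type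
   carries the product (= Borel) sigma-algebra, whereas 'rV[R]_k has no
   measurable structure and is normed by the sup norm. *)
Definition edist (R : realType) (k : nat) (x y : k.-tuple R) : R :=
  Num.sqrt (\sum_(i < k) (tnth x i - tnth y i) ^+ 2).

Definition ebounded (R : realType) (k : nat) (D : set (k.-tuple R)) : Prop :=
  exists M : R, forall x y, D x -> D y -> edist x y <= M.

(* k-dimensional Lebesgue measure of a Borel set, as the k-fold iterated
   product of the Lebesgue measure of R (cf. [product_measure1]). *)
Fixpoint volume (R : realType) (k : nat) : set (k.-tuple R) -> \bar R :=
  match k with
  | 0 => fun A => \d_([tuple] : 0.-tuple R) A
  | k'.+1 => fun A =>
      (\int[@lebesgue_measure R]_x
         volume [set t : k'.-tuple R | A [tuple of (x : R) :: t]])%E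
  end.

(* X has the uniform law on D. Only meaningful for a Borel set D of positive
   finite volume. *)
Definition uniform_on d (T : measurableType d) (R : realType)
    (P : probability T R) (k : nat) (D : set (k.-tuple R))
    (X : T -> k.-tuple R) : Prop :=
  forall A, measurable A ->
    P (X @^-1` A) = ((fine (volume (A `&` D)) / fine (volume D))%:E)%E.

Definition independent d (T : measurableType d) (R : realType)
    (P : probability T R) d1 (T1 : measurableType d1)
    d2 (T2 : measurableType d2) (X : T -> T1) (Y : T -> T2) : Prop :=
  forall A B, measurable A -> measurable B ->
    P ((X @^-1` A) `&` (Y @^-1` B)) = (P (X @^-1` A) * P (Y @^-1` B))%E.

(* g is a density on (0, +oo) of the law of Z; values of g outside (0, +oo)
   are irrelevant. *)
Definition density_on_pos d (T : measurableType d) (R : realType)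
    (P : probability T R) (Z : T -> R) (g : R -> R) : Prop :=
  [/\ measurable_fun (pos_reals R) g,
      forall t, 0 < t -> 0 <= g t &
      forall A : set R, measurable A ->
        P (Z @^-1` A) =
        (\int[lebesgue_measure]_(t in A `&` pos_reals R) (g t)%:E)%E].

Definition Gamma (R : realType) (x : R) : R :=
  \int[lebesgue_measure]_(t in pos_reals R) (t `^ (x - 1) * expR (- t)).

Definition laplace (R : realType) (g : R -> R) (s : R) : R :=
  \int[lebesgue_measure]_(t in pos_reals R) (expR (- (s * t)) * g t).

(* The function h = - G' / G, G the Laplace transform of g. *)
Definition lap_ratio (R : realType) (g : R -> R) (s : R) : R :=
  - derive1 (laplace g) s / laplace g s.

(* d_max is the mean distance, not the diameter. *)
Definition dmax (R : realType) (g : R -> R) : R :=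
  \int[lebesgue_measure]_(t in pos_reals R) (t * g t).

(* Main.v *)
Require Import Defs.
From mathcomp Require Import ring lra measurable_realfun.

(** The density g of the distance has total mass 1 and, since both points lie
almost surely in the bounded region, vanishes almost everywhere beyond some
bound M ([edist_le_ae]). Hence all exponential moments of
g are finite ([exp_integrable_bounded_support]), so that the Laplace transform
G of g is defined and differentiable on the whole line, under the integral
sign ([is_derive_laplace]); in particular the two-sided derivative at 0 makes
sense, and h = - G' / G is the ratio of the Laplace transforms of t g(t) and
g(t). This gives continuity, positivity and h(0) = dmax.

h(s) is the mean of the law with density proportional to exp(-su) g(u). With
a = h(s), the function (u - a) exp(-su) g(u) has integral 0, and multiplying it
by exp(-(t-s)u), t > s, gives less weight to u > a than to u < a; the integral
becomes negative, which says h(t) < a ([lap_ratio_decreasing]). The inequality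
is strict because a nonnegative weight that vanishes at one point only has a
positive integral against g ([Rintegral_weighted_gt0]).

For the limit at infinity ([lap_ratio_cvg0]), the pointwise bound
t exp(-st) <= d exp(-st) + exp(-sd) t, for d > 0, gives
h(s) <= d + exp(-sd) dmax / G(s), while G(s) is at least exp(-sd/2) times the
mass of g on ]0, d/2]. That mass is positive by the behaviour of g near 0, once
the constant in front of t^(k-1) is known to be positive; as Gamma is a
real-valued integral that would be 0 if it diverged, this includes the
convergence of the integral ([Gamma_gt0]).

Existence of a solution is then the intermediate value theorem
([lap_ratio_surj]); uniqueness and the bound h <= dmax are monotonicity. *)

Set Implicit Arguments.
Unset Strict Implicit.
Unset Printing Implicit Defensive.

Local Open Scope classical_set_scope.
Local Open Scope ring_scope.

(** * Strict positivity of integrals *)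

(** Were the integral of f zero, f would vanish almost everywhere, hence so
would w. *)
Lemma Rintegral_gt0_of_ae_zero d (T : measurableType d) (R : realType)
    (mu : {measure set T -> \bar R}) (D : set T) (f w : T -> R) :
  measurable D ->
  mu.-integrable D (EFin \o f) -> mu.-integrable D (EFin \o w) ->
  (forall x, D x -> 0 <= f x) ->
  {ae mu, forall x, D x -> f x = 0 -> w x = 0} ->
  0 < \int[mu]_(x in D) w x -> 0 < \int[mu]_(x in D) f x.
Proof.
move=> mD intf intw f0 fw w0; rewrite lt_neqAle Rintegral_ge0// andbT eq_sym.
apply: contraTN w0 => /eqP int0; rewrite -leNgt.
have mf := measurable_int mu intf; have mw := measurable_int mu intw.
have aef : ae_eq mu D (EFin \o f) (cst 0%E).
  apply/(ae_eq_integral_abs _ mD mf).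
  transitivity (\int[mu]_(x in D) (f x)%:E)%E.
    by apply: eq_integral => x /set_mem Dx /=; rewrite ger0_norm// f0.
  rewrite -[LHS]fineK ?(integrable_fin_num mD intf)//.
  by rewrite -/(Rintegral _ _ _) int0.
rewrite le_eqVlt; apply/orP; left; apply/eqP.
rewrite /Rintegral (ae_eq_integral (cst 0%E))//; first by rewrite integral0.
apply: filterS2 aef fw => x /= fx fwx Dx; congr (_%:E).
by apply: (fwx Dx); have [] := fx Dx.
Qed.

(** * The Laplace transform of a function with exponential moments *)

Section exponential_moments.
Context {R : realType}.
Notation mu := (@lebesgue_measure R).
Notation pos := (pos_reals R).

(** The type ascription selects the sigma-algebra that carries
[lebesgue_measure], which differs from the default instance on R by its
display. *)
Lemma measurable_pos_reals : measurable (pos : set (measurableTypeR R)).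
Proof. exact: measurable_itv. Qed.

Lemma in_pos_reals (t : R) : pos t = (0 < t) :> Prop.
Proof. by rewrite /pos_reals /= in_itv/= andbT. Qed.

(** Exponents of both signs are allowed, so that the Laplace transform is
finite on the whole line and differentiable at 0 from both sides. *)
Definition exp_integrable (f : R -> R) :=
  forall K, mu.-integrable pos (EFin \o (fun t => expR (K * t) * f t)).

Lemma exp_integrable_integrable f : exp_integrable f ->
  mu.-integrable pos (EFin \o f).
Proof.
move=> /(_ 0); apply: eq_integrable; first exact: measurable_pos_reals.
by move=> t _ /=; rewrite mul0r expR0 mul1r.
Qed.

Lemma exp_integrable_measurable f : exp_integrable f -> measurable_fun pos f.
Proof.
by move=> /exp_integrable_integrable/measurable_int /measurable_EFinP.
Qed.

Lemma measurable_expM (K : R) (D : set R) :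
  measurable_fun D (fun t => expR (K * t)).
Proof.
apply: measurable_funS (@measurableT _ _) (@subsetT _ _) _.
apply: measurableT_comp; first exact: measurable_expR.
exact: mulrl_measurable.
Qed.

(** Since t <= exp t, a factor t costs one unit in the exponent. *)
Lemma exp_integrable_mul_id f : exp_integrable f ->
  exp_integrable (fun t => t * f t).
Proof.
move=> intf K; have mf := exp_integrable_measurable intf.
apply: le_integrable (intf (K + 1)); first exact: measurable_pos_reals.
  apply/measurable_EFinP; apply: measurable_funM; first exact: measurable_expM.
  exact: measurable_funM.
move=> t; rewrite in_pos_reals => t0 /=; rewrite lee_fin !normrM.
rewrite !(ger0_norm (expR_ge0 _)) mulrA ler_wpM2r// (gtr0_norm t0).
rewrite mulrDl mul1r expRD ler_wpM2l ?expR_ge0//.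
by apply: le_trans (expR_ge1Dx _); rewrite lerDr.
Qed.

Lemma exp_integrable_laplace f (s : R) : exp_integrable f ->
  mu.-integrable pos (EFin \o (fun t => expR (- (s * t)) * f t)).
Proof.
move=> /(_ (- s)); apply: eq_integrable; first exact: measurable_pos_reals.
by move=> t _ /=; rewrite mulNr.
Qed.

Lemma is_derive_laplace_kernel (f : R -> R) (x t : R) :
  is_derive x 1 (fun s => expR (- (s * t)) * f t)
    (- (expR (- (x * t)) * (t * f t))).
Proof.
have dN : is_derive x 1 (fun s => - (s * t)) (- t).
  have -> : (fun s : R => - (s * t)) = (fun s => s * - t).
    by apply/funext => s; rewrite mulrN.
  have := is_deriveM (is_derive_id x 1) (is_derive_cst (- t) x 1).
  by rewrite scaler0 add0r /GRing.scale/= mulr1.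
have dexp := @is_derive1_comp _ expR (fun s => - (s * t)) x _ _
  (is_derive_expR _) dN.
have := is_deriveM dexp (is_derive_cst (f t) x 1).
rewrite scaler0 add0r => dK; apply: is_derive_eq dK _.
by rewrite /GRing.scale/=; ring.
Qed.

(** For x in ]s - 1, s + 1[ and t > 0 the derivative of the kernel is bounded
in absolute value by exp((1 - s) t) |t f(t)|, which is integrable by assumption
on f; this allows differentiation under the integral sign, for s of any
sign. *)
Lemma is_derive_laplace f (s : R) : exp_integrable f ->
  is_derive s 1 (laplace f) (- laplace (fun t => t * f t) s).
Proof.
move=> intf; have intf1 := exp_integrable_mul_id intf.
have sI : `]s - 1, s + 1[%classic s by rewrite /= in_itv/=; lra.
have intx (x : R) : `]s - 1, s + 1[%classic x ->
    mu.-integrable pos (EFin \o (fun t => expR (- (x * t)) * f t)).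
  by move=> _; exact: exp_integrable_laplace.
have derx (x t : R) : `]s - 1, s + 1[%classic x -> pos t ->
    derivable (fun y : R => expR (- (y * t)) * f t) x 1.
  by move=> _ _; have [] := is_derive_laplace_kernel f x t.
pose G t := `|expR ((1 - s) * t) * (t * f t)|.
have G0 t : 0 <= G t by exact: normr_ge0.
have intG : mu.-integrable pos (EFin \o G).
  exact: integrable_norm (intf1 (1 - s)).
have Gub (x t : R) : `]s - 1, s + 1[%classic x -> pos t ->
    `|partial1of2 (fun y t : R => expR (- (y * t)) * f t) x t| <= G t.
  rewrite /= in_itv/= in_pos_reals => /andP[sx _] t0.
  rewrite /partial1of2 derive1E.
  have [_ ->] := is_derive_laplace_kernel f x t.
  rewrite normrN /G !normrM !(ger0_norm (expR_ge0 _)) ler_wpM2r//.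
  by rewrite ler_expR -mulNr ler_wpM2r ?(ltW t0)//; lra.
have mpos := measurable_pos_reals.
split.
  exact: (derivable_under_integral mpos sI intx derx G0 intG Gub).
rewrite -derive1E.
rewrite (differentiation_under_integral mpos sI intx derx G0 intG Gub).
rewrite /laplace -mulN1r -RintegralZl//; last exact: exp_integrable_laplace.
apply: eq_Rintegral => t _.
rewrite /partial1of2 derive1E.
by have [_ ->] := is_derive_laplace_kernel f s t; rewrite mulN1r.
Qed.

Lemma continuous_laplace f : exp_integrable f -> continuous (laplace f).
Proof.
move=> intf s; apply: differentiable_continuous.
by apply/derivable1_diffP; have [] := is_derive_laplace s intf.
Qed.

Lemma derive1_laplace f (s : R) : exp_integrable f ->
  derive1 (laplace f) s = - laplace (fun t => t * f t) s.
Proof. by move=> /(is_derive_laplace s)[_ <-]; rewrite derive1E. Qed.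

Lemma dmaxE (f : R -> R) : dmax f = laplace (fun t => t * f t) 0.
Proof. by apply: eq_Rintegral => t _; rewrite mul0r oppr0 expR0 mul1r. Qed.

End exponential_moments.

(** * The logarithmic derivative of the Laplace transform *)

Definition positive_mass_near0 (R : realType) (g : R -> R) :=
  forall e, 0 < e ->
    0 < \int[lebesgue_measure]_(t in pos_reals R) (\1_`]0, e] t * g t).

Section laplace_ratio.
Context {R : realType} (g : R -> R).
Notation mu := (@lebesgue_measure R).
Notation pos := (pos_reals R).

Hypothesis g_ge0 : forall t, 0 < t -> 0 <= g t.
Hypothesis g_exp : exp_integrable g.
Hypothesis g_mass : 0 < \int[mu]_(t in pos) g t.

Let g1_exp : exp_integrable (fun t => t * g t) := exp_integrable_mul_id g_exp.

(** g is not almost everywhere 0, and a single point a is negligible. *)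
Lemma Rintegral_weighted_gt0 (w : R -> R) (a : R) :
  mu.-integrable pos (EFin \o (fun t => w t * g t)) ->
  (forall t, 0 < t -> 0 <= w t) -> (forall t, 0 < t -> t != a -> w t != 0) ->
  0 < \int[mu]_(t in pos) (w t * g t).
Proof.
move=> intwg w0 wN0.
apply: (Rintegral_gt0_of_ae_zero measurable_pos_reals intwg
  (exp_integrable_integrable g_exp)) g_mass.
  by move=> t; rewrite in_pos_reals => t0; rewrite mulr_ge0 ?w0 ?g_ge0.
exists [set a]; split; [exact: measurable_set1|exact: lebesgue_measure_set1|].
move=> t /=; apply: contra_notP => /eqP ta; rewrite in_pos_reals => t0 /eqP.
by rewrite mulf_eq0 (negbTE (wN0 _ t0 ta)) => /eqP.
Qed.

Lemma laplace_gt0 s : 0 < laplace g s.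
Proof.
apply: (Rintegral_weighted_gt0 (a := 0)); first exact: exp_integrable_laplace.
- by move=> t _; exact: expR_ge0.
- by move=> t _ _; rewrite gt_eqF ?expR_gt0.
Qed.

Lemma laplace_mul_id_gt0 s : 0 < laplace (fun t => t * g t) s.
Proof.
have intL := exp_integrable_laplace s g1_exp.
rewrite /laplace; under eq_Rintegral do rewrite mulrA.
apply: (Rintegral_weighted_gt0 (a := 0)).
- apply: eq_integrable intL => [|t _ /=]; first exact: measurable_pos_reals.
  by rewrite mulrA.
- by move=> t t0; rewrite mulr_ge0 ?expR_ge0 ?ltW.
- by move=> t t0 _; rewrite mulf_neq0 ?gt_eqF ?expR_gt0.
Qed.

Lemma lap_ratioE s : lap_ratio g s = laplace (fun t => t * g t) s / laplace g s.
Proof. by rewrite /lap_ratio derive1_laplace// opprK. Qed.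

Lemma lap_ratio_gt0 s : 0 < lap_ratio g s.
Proof. by rewrite lap_ratioE divr_gt0 ?laplace_mul_id_gt0 ?laplace_gt0. Qed.

Lemma continuous_lap_ratio : continuous (lap_ratio g).
Proof.
rewrite (_ : lap_ratio g = fun s => laplace (fun t => t * g t) s / laplace g s).
  move=> s; apply: cvgM; first exact: continuous_laplace.
  by apply: cvgV; [rewrite gt_eqF ?laplace_gt0|exact: continuous_laplace].
by apply/funext => s; rewrite lap_ratioE.
Qed.

Lemma lap_ratio0 : \int[mu]_(t in pos) g t = 1 -> lap_ratio g 0 = dmax g.
Proof.
move=> g1; rewrite lap_ratioE -dmaxE /laplace.
under [X in _ / X]eq_Rintegral do rewrite mul0r oppr0 expR0 mul1r.
by rewrite g1 divr1.
Qed.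

(** With a = h(s), the integral of (u - a) exp(-su) g(u) is 0. For t > s and
u <> a one has (u - a) exp(-tu) < c (u - a) exp(-su) with c = exp(-(t-s)a),
since u - a and c - exp(-(t-s)u) have the same sign. Integrating against g gives
L(t) - a G(t) < 0, where L and G are the Laplace transforms of u g(u) and
g(u). *)
Lemma lap_ratio_decreasing s t : s < t -> lap_ratio g t < lap_ratio g s.
Proof.
move=> st; set a := lap_ratio g s; pose c := expR (- ((t - s) * a)).
have La x := exp_integrable_laplace x g_exp.
have L1 x := exp_integrable_laplace x g1_exp.
have mpos := @measurable_pos_reals R.
(* [K x u] is (u - a) exp(-xu) g(u), with the two terms kept apart. *)
pose K x (u : R) := expR (- (x * u)) * (u * g u) - a * (expR (- (x * u)) * g u).
have intK x : mu.-integrable pos (EFin \o K x).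
  have := integrableZl mpos a (La x) => /(integrableB mpos (L1 x)).
  by apply: eq_integrable.
have KE x : \int[mu]_(u in pos) K x u =
    laplace (fun t => t * g t) x - a * laplace g x.
  rewrite RintegralB// ?RintegralZl//.
  exact: (integrableZl mpos a (La x)).
have K0 : \int[mu]_(u in pos) K s u = 0.
  by rewrite KE /a lap_ratioE divfK ?subrr// gt_eqF ?laplace_gt0.
pose w (u : R) := (u - a) * (c * expR (- (s * u)) - expR (- (t * u))).
have wE u : w u * g u = c * K s u - K t u by rewrite /w /K; ring.
have intcK : mu.-integrable pos (EFin \o (fun u => c * K s u)).
  exact: (integrableZl mpos c (intK s)).
have wgE : \int[mu]_(u in pos) (w u * g u) = - \int[mu]_(u in pos) K t u.
  under eq_Rintegral do rewrite wE.
  by rewrite RintegralB// RintegralZl// K0 mulr0 sub0r.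
have wsplit u : w u = (u - a) * expR (- (s * u)) * (c - expR (- ((t - s) * u))).
  rewrite /w; have -> : - (t * u) = - (s * u) + - ((t - s) * u) by ring.
  by rewrite expRD; ring.
have expa u v : (expR (- ((t - s) * u)) < expR (- ((t - s) * v))) = (v < u).
  by rewrite ltr_expR ltrN2 ltr_pM2l// subr_gt0.
have w_gt0 u : u != a -> 0 < w u.
  rewrite neq_lt wsplit => /orP[ua|ua].
    rewrite nmulr_lgt0 ?subr_lt0 ?expa//.
    by rewrite pmulr_llt0 ?expR_gt0 ?subr_lt0.
  by rewrite !mulr_gt0 ?expR_gt0 ?subr_gt0 ?expa.
have : 0 < \int[mu]_(u in pos) (w u * g u).
  apply: (Rintegral_weighted_gt0 (a := a)).
  - have := integrableB mpos intcK (intK t); apply: eq_integrable => // u _ /=.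
    by rewrite wE EFinB.
  - move=> u _; have [->|/w_gt0/ltW//] := eqVneq u a.
    by rewrite /w subrr mul0r.
  - by move=> u _ ua; rewrite gt_eqF ?w_gt0.
rewrite wgE KE oppr_gt0 subr_lt0 => lt1.
by rewrite lap_ratioE ltr_pdivrMr ?laplace_gt0.
Qed.

Lemma integrable_truncated (e : R) :
  mu.-integrable pos (EFin \o (fun t => \1_`]0, e] t * g t)).
Proof.
have mg := exp_integrable_measurable g_exp.
apply: le_integrable (exp_integrable_integrable g_exp).
- exact: measurable_pos_reals.
- apply/measurable_EFinP; apply: measurable_funM => //.
- move=> t _ /=; rewrite lee_fin normrM ler_piMl//.
  by rewrite indicE; case: (_ \in _); rewrite ?normr1 ?normr0.
Qed.

(** Pointwise, t exp(-st) <= e exp(-st) when t <= e, and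
t exp(-st) <= exp(-se) t otherwise. *)
Lemma laplace_mul_id_le (s e : R) : 0 <= s -> 0 <= e ->
  laplace (fun t => t * g t) s <= e * laplace g s + expR (- (s * e)) * dmax g.
Proof.
move=> s0 e0; have mpos := @measurable_pos_reals R.
have intL := exp_integrable_laplace s g_exp.
have int1 := exp_integrable_integrable g1_exp.
rewrite /laplace /dmax -!RintegralZl// -RintegralD//; last 2 first.
- exact: (integrableZl mpos e intL).
- exact: (integrableZl mpos _ int1).
apply: le_Rintegral => //.
- exact: exp_integrable_laplace.
- have := integrableD mpos (integrableZl mpos e intL)
    (integrableZl mpos (expR (- (s * e))) int1).
  exact: eq_integrable.
move=> t; rewrite in_pos_reals => t0; rewrite !mulrA -mulrDl ler_wpM2r ?g_ge0//.
have [te|et] := lerP t e.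
  rewrite mulrC -[leLHS]addr0 lerD// ?mulr_ge0 ?expR_ge0 ?(ltW t0)//.
  by rewrite ler_wpM2r ?expR_ge0.
rewrite -[leLHS]add0r lerD ?mulr_ge0 ?expR_ge0//.
by rewrite ler_wpM2r ?(ltW t0)// ler_expR lerN2 ler_wpM2l// ltW.
Qed.

(** Only the mass of g on ]0, e] is kept, where exp(-st) >= exp(-se). *)
Lemma laplace_ge (s e : R) : 0 <= s ->
  expR (- (s * e)) * \int[mu]_(t in pos) (\1_`]0, e] t * g t) <= laplace g s.
Proof.
move=> s0; have mpos := @measurable_pos_reals R.
have intt := integrable_truncated e.
rewrite -RintegralZl//; apply: le_Rintegral => //.
- exact: (integrableZl mpos _ intt).
- exact: exp_integrable_laplace.
move=> t; rewrite in_pos_reals => t0; rewrite mulrA ler_wpM2r ?g_ge0//.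
rewrite indicE; case: (boolP (t \in _)) => [|_]; last by rewrite mulr0 expR_ge0.
rewrite inE/= in_itv/= => /andP[_ te].
by rewrite mulr1 ler_expR lerN2 ler_wpM2l.
Qed.

(** For a tolerance e, take d = e/2 in [laplace_mul_id_le] and d/2 in
[laplace_ge]: the quotient is at most d + exp(-sd/2) dmax / m, with m the mass of g on ]0, d/2]. *)
Lemma lap_ratio_cvg0 : positive_mass_near0 g ->
  lap_ratio g s @[s --> +oo] --> 0.
Proof.
move=> mass0; apply/cvgrPdist_le => e e0.
pose d := e / 2; pose h := d / 2.
have d0 : 0 < d by rewrite divr_gt0.
have h0 : 0 < h by rewrite divr_gt0.
pose m := \int[mu]_(t in pos) (\1_`]0, h] t * g t).
have m0 : 0 < m by exact: mass0.
have D0 : 0 <= dmax g by rewrite dmaxE ltW// laplace_mul_id_gt0.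
near=> s.
have s0 : 0 < s by near: s; exact: nbhs_pinfty_gt.
have s1 : dmax g / (m * h * d) <= s.
  by near: s; apply: nbhs_pinfty_ge; exact: num_real.
rewrite sub0r normrN gtr0_norm ?lap_ratio_gt0//.
rewrite lap_ratioE// ler_pdivrMr ?laplace_gt0//.
apply: le_trans (laplace_mul_id_le (ltW s0) (ltW d0)) _.
have -> : e = d + d by rewrite /d; field.
rewrite mulrDl lerD2l.
apply: le_trans (ler_wpM2l (ltW d0) (laplace_ge h (ltW s0))).
have -> : - (s * d) = - (s * h) - s * h by rewrite /h; field.
rewrite expRD -mulrA [leRHS]mulrCA ler_wpM2l ?expR_ge0//.
rewrite -/m expRN ler_pdivrMl ?expR_gt0//.
(* The crude bound x <= exp x is enough to absorb the exponential. *)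
have sh : s * h <= expR (s * h).
  by apply: le_trans (expR_ge1Dx _); rewrite lerDr.
apply: (le_trans _ (ler_wpM2r _ sh)); last by rewrite mulr_ge0 ?ltW.
move: s1; rewrite ler_pdivrMr ?mulr_gt0// => /le_trans; apply.
by rewrite le_eqVlt; apply/orP; left; apply/eqP; ring.
Unshelve. all: by end_near.
Qed.

Lemma lap_ratio_le_dmax s : \int[mu]_(t in pos) g t = 1 ->
  0 <= s -> lap_ratio g s <= dmax g.
Proof.
move=> g1; rewrite le_eqVlt -(lap_ratio0 g1) => /predU1P[<-//|s0].
by rewrite ltW// lap_ratio_decreasing.
Qed.

Lemma lap_ratio_surj d : \int[mu]_(t in pos) g t = 1 -> positive_mass_near0 g ->
  0 < d -> d <= dmax g -> exists2 s, 0 <= s & lap_ratio g s = d.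
Proof.
move=> g1 mass0 d0 dle.
have /cvgrPdist_lt/(_ _ d0) := lap_ratio_cvg0 mass0.
move=> hd.
have [b [b0 hb]] : exists b, 0 <= b /\ lap_ratio g b < d.
  near (pinfty_nbhs R) => b.
  have b0 : 0 < b by near: b; exact: nbhs_pinfty_gt.
  exists b; split; first exact: ltW.
  have : `|0 - lap_ratio g b| < d by near: b.
  by rewrite sub0r normrN gtr0_norm// lap_ratio_gt0.
have := @IVT R (lap_ratio g) 0 b d b0.
case.
- by apply: continuous_subspaceT; exact: continuous_lap_ratio.
- by rewrite (lap_ratio0 g1) ge_min le_max dle (ltW hb) orbT.
- by move=> s; rewrite in_itv/= => /andP[s0 _] hs; exists s.
Unshelve. all: by end_near.
Qed.

End laplace_ratio.

(** * Densities with bounded support that charge every neighbourhood of 0 *)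

Section bounded_support.
Context {R : realType}.
Notation mu := (@lebesgue_measure R).
Notation pos := (pos_reals R).

(** g is almost everywhere 0 beyond M, so exp(Kt) g(t) is almost everywhere
bounded by exp(|K| |M|) g(t). *)
Lemma exp_integrable_bounded_support (g : R -> R) (M : R) :
  mu.-integrable pos (EFin \o g) ->
  (forall t, 0 < t -> 0 <= g t) ->
  (\int[mu]_(t in `]M, +oo[ `&` pos) (g t)%:E = 0)%E ->
  exp_integrable g.
Proof.
move=> intg g0 gM K; have mpos := @measurable_pos_reals R.
have mM : measurable (`]M, +oo[ : set (measurableTypeR R)).
  exact: measurable_itv.
have mMpos := measurableI _ _ mM mpos.
have mg := measurable_int mu intg.
have mgR : measurable_fun (pos : set (measurableTypeR R)) g.
  exact/measurable_EFinP.
have g_ae : ae_eq mu (`]M, +oo[ `&` pos) (EFin \o g) (cst 0%E).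
  apply/ae_eq_integral_abs => //.
    by apply: measurable_funS mg => //; exact: subIsetr.
  rewrite -{}gM; apply: eq_integral => t /set_mem[_] /=.
  by rewrite in_pos_reals => t0; rewrite ger0_norm// g0.
have mK : measurable_fun (pos : set (measurableTypeR R))
    (fun t => expR (K * t) * g t).
  by apply: measurable_funM => //; exact: measurable_expM.
pose C := expR (`|K| * `|M|).
apply/integrableP; split; first exact/measurable_EFinP.
have intCg := integrableZl mpos C intg.
have CgE : (\int[mu]_(t in pos) (C%:E * (EFin \o g) t) < +oo)%E.
  have := integrable_fin_num mpos intCg.
  by rewrite fin_numE ltey => /andP[_ ->].
apply: le_lt_trans CgE; apply: ae_ge0_le_integral => //.
- by apply/measurable_EFinP/measurableT_comp.
- move=> t; rewrite in_pos_reals => t0.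
  by rewrite mule_ge0// lee_fin ?expR_ge0// g0.
- exact: measurable_int intCg.
- apply: filterS g_ae => t gt0; rewrite in_pos_reals => t0.
  rewrite /= lee_fin ger0_norm ?mulr_ge0 ?expR_ge0 ?g0//.
  have [tM|Mt] := leP t M.
    rewrite ler_wpM2r ?g0// ler_expR; apply: le_trans (ler_norm _) _.
    rewrite normrM ler_wpM2l// !ger0_norm ?(ltW t0)//.
    exact: le_trans (ltW t0) tM.
  have [->] : (g t)%:E = 0%E; last by rewrite !mulr0.
  by apply: gt0; split; [rewrite /= in_itv/= Mt|rewrite in_pos_reals].
Qed.

(** f is compared with the indicator of a small interval ]0, r] on which it is
positive. *)
Lemma Rintegral_gt0_of_near0 (f : R -> R) :
  mu.-integrable pos (EFin \o f) -> (forall t, 0 < t -> 0 <= f t) ->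
  (\forall t \near 0^'+, 0 < f t) -> 0 < \int[mu]_(t in pos) f t.
Proof.
move=> intf f0; rewrite near_withinE near_nbhs => - /nbhs_ballP[d /= d0 hd].
pose r := d / 2.
have r0 : 0 < r by rewrite divr_gt0.
have mpos := @measurable_pos_reals R.
have mr : measurable (`]0, r] : set (measurableTypeR R)).
  exact: measurable_itv.
have indE : (\int[mu]_(t in pos) (\1_`]0, r] t)%:E = r%:E)%E.
  rewrite integral_indic// setIidl.
    apply: (etrans (lebesgue_measure_itv `]0, r])).
    by rewrite /= lte_fin r0 oppr0 adde0.
  by move=> t /=; rewrite in_itv/= in_pos_reals => /andP[].
apply: (Rintegral_gt0_of_ae_zero (T := measurableTypeR R) (w := \1_`]0, r])
  mpos intf).
- apply/integrableP; split.
    by apply/measurable_EFinP; exact: measurable_indic.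
  under eq_integral do rewrite /= ger0_norm//.
  by rewrite indE ltry.
- by move=> t; rewrite in_pos_reals => t0; rewrite f0.
- apply: nearW => t; rewrite in_pos_reals => t0 /eqP.
  rewrite indicE; case: (boolP (t \in (`]0, r]%classic : set R))) => //.
  rewrite inE/= in_itv/= t0/= => tr.
  rewrite gt_eqF//; apply: hd => //; rewrite /ball/=.
  rewrite sub0r normrN gtr0_norm// (le_lt_trans tr)//.
  by rewrite ltr_pdivrMr// ltr_pMr// ltr1n.
- by rewrite /Rintegral indE.
Qed.

Lemma positive_mass_near0_of_near (g : R -> R) :
  exp_integrable g -> (forall t, 0 < t -> 0 <= g t) ->
  (\forall t \near 0^'+, 0 < g t) -> positive_mass_near0 g.
Proof.
move=> g_exp g0 g_near e e0.
apply: (Rintegral_gt0_of_near0 (integrable_truncated g_exp e)).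
  by move=> t t0; rewrite mulr_ge0// g0.
near=> t; rewrite indicE mem_set/= ?mul1r; first by near: t.
rewrite in_itv/=; apply/andP; split; near: t; first exact: nbhs_right_gt.
exact: nbhs_right_le.
Unshelve. all: by end_near.
Qed.

End bounded_support.

(** * Positivity of the Gamma function *)

Section gamma.
Context {R : realType}.
Notation mu := (@lebesgue_measure R).
Notation pos := (pos_reals R).

(** Put u = t / 2a; then a ln t = a ln (2a) + a ln u, and ln u <= u. *)
Lemma powR_le_expR (a t : R) : 0 < a -> 0 < t ->
  t `^ a <= (a + a) `^ a * expR (t / 2).
Proof.
move=> a0 t0; have aa0 : 0 < a + a by rewrite addr_gt0.
rewrite /powR !gt_eqF// -expRD ler_expR.
have ht : t = (a + a) * (t / (a + a)) by field; rewrite gt_eqF.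
have u0 : 0 < t / (a + a) by rewrite divr_gt0.
rewrite {1}ht lnM ?posrE// mulrDr lerD2l.
have -> : t / 2 = a * (t / (a + a)) by field; rewrite gt_eqF.
rewrite ler_wpM2l ?(ltW a0)//; set u := t / (a + a) in u0 *.
have := @le_ln1Dx _ (u - 1); rewrite [1 + _]addrC subrK => lnu.
by apply: le_trans (lnu _) _; [rewrite ltrBrDl subrr|rewrite gerBl].
Qed.

(** Up to a constant, this is the density of the exponential law of rate
1/2. *)
Lemma integrable_expR_half :
  mu.-integrable pos (EFin \o (fun t => expR (- (t / 2)))).
Proof.
have mpos := @measurable_pos_reals R.
have h0 : 0 < 2^-1 :> R by rewrite invr_gt0.
have pE t : pos t -> exponential_pdf 2^-1 t = 2^-1 * expR (- (t / 2)).
  rewrite in_pos_reals => t0; rewrite /exponential_pdf patchE mem_set/=.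
    by rewrite mulNr [2^-1 * t]mulrC.
  by rewrite in_itv/= andbT ltW.
have mE : measurable_fun (pos : set (measurableTypeR R))
    (fun t => expR (- (t / 2))).
  have := @measurable_expM R (- 2^-1) pos; apply: eq_measurable_fun => t _.
  by rewrite mulNr [2^-1 * t]mulrC.
apply/integrableP; split; first exact/measurable_EFinP.
apply: (@le_lt_trans _ _
    (\int[mu]_(t in pos) (2%:E * (exponential_pdf 2^-1 t)%:E))%E).
  rewrite le_eqVlt; apply/orP; left; apply/eqP.
  apply: eq_integral => t /set_mem tp.
  by rewrite /= ger0_norm ?expR_ge0// pE// -EFinM mulrA divff ?mul1r.
have mpdf : measurable_fun (setT : set (measurableTypeR R))
    (exponential_pdf (2^-1 : R)).
  exact: measurable_exponential_pdf.
rewrite ge0_integralZl//.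
- apply: (@le_lt_trans _ _ (2%:E * \int[mu]_t (exponential_pdf 2^-1 t)%:E)%E).
    rewrite lee_wpmul2l ?lee_fin//; apply: ge0_subset_integral => //.
      exact/measurable_EFinP.
    by move=> t _; rewrite lee_fin exponential_pdf_ge0// ltW.
  by rewrite integral_exponential_pdf// mule1 ltry.
- by apply/measurable_EFinP; apply: measurable_funS mpdf.
- by move=> t _; rewrite lee_fin exponential_pdf_ge0// ltW.
Qed.

(** The integrand is at most a constant times exp(-t/2), by [powR_le_expR]; so
the integral is finite and its real-valued version is not the default value
0. *)
Lemma Gamma_gt0 (x : R) : 1 < x -> 0 < Gamma x.
Proof.
move=> x1; have mpos := @measurable_pos_reals R.
pose a := x - 1; have a0 : 0 < a by rewrite subr_gt0.
have intE := integrable_expR_half.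
have mf : measurable_fun (pos : set (measurableTypeR R))
    (fun t => t `^ (x - 1) * expR (- t)).
  apply: measurable_funM.
    by apply: measurable_funTS; exact: measurable_powR.
  have := @measurable_expM R (- 1) pos; apply: eq_measurable_fun => t _.
  by rewrite mulN1r.
have intG : mu.-integrable pos (EFin \o (fun t => t `^ (x - 1) * expR (- t))).
  apply: le_integrable (integrableZl mpos ((a + a) `^ a) intE) => //.
    exact/measurable_EFinP.
  move=> t; rewrite in_pos_reals => t0 /=.
  rewrite lee_fin !ger0_norm ?mulr_ge0 ?expR_ge0 ?powR_ge0//.
  apply: le_trans (ler_wpM2r (expR_ge0 _) (powR_le_expR a0 t0)) _.
  by rewrite -mulrA -expRD ler_wpM2l ?powR_ge0// ler_expR; lra.
apply: (Rintegral_gt0_of_near0 intG).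
  by move=> t _; rewrite mulr_ge0 ?powR_ge0 ?expR_ge0.
near=> t; have t0 : 0 < t by near: t; exact: nbhs_right_gt.
by rewrite mulr_gt0 ?powR_gt0 ?expR_gt0.
Unshelve. all: by end_near.
Qed.

End gamma.

(** * The distance between two random points of a bounded region *)

Section distance_law.
Context {R : realType} {k : nat}.

Lemma volume0 : volume (set0 : set (k.-tuple R)) = 0%E.
Proof.
elim: k => [|n IH] /=; first by rewrite dirac0.
under eq_integral => x _.
  rewrite (_ : [set t | _] = set0); last by rewrite -subset0.
  rewrite IH; over.
exact: integral0.
Qed.

Context d (T : measurableType d) (P : probability T R).

(** The quotient defining the uniform law has for numerator the volume of
D minus D, that is 0. *)
Lemma uniform_on_setC (D : set (k.-tuple R)) (X : T -> k.-tuple R) :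
  measurable D -> uniform_on P D X -> P (X @^-1` (~` D)) = 0%E.
Proof.
move=> mD /(_ (~` D) (measurableC mD)) ->.
by rewrite setICl volume0 mul0r.
Qed.

Lemma measurable_edist (X Y : {RV P >-> k.-tuple R}) :
  measurable_fun setT (fun w => edist (X w) (Y w)).
Proof.
apply: (@measurableT_comp _ _ _ _ _ _ (@Num.sqrt R)).
  by apply: continuous_measurable_fun; exact: sqrt_continuous.
apply: measurable_sum => i; apply: measurable_funX.
by apply: measurable_funB; apply: (measurableT_comp (measurable_tnth i)).
Qed.

(** If the distance exceeds M then X or Y lies outside D, which has
probability 0. *)
Lemma edist_le_ae (D : set (k.-tuple R)) (M : R) (X Y : {RV P >-> k.-tuple R}) :
  measurable D -> (forall x y, D x -> D y -> edist x y <= M) ->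
  uniform_on P D X -> uniform_on P D Y ->
  P ((fun w => edist (X w) (Y w)) @^-1` `]M, +oo[) = 0%E.
Proof.
move=> mD DM /(uniform_on_setC mD) X0 /(uniform_on_setC mD) Y0.
have mC := measurableC mD.
have mpre (Z : {RV P >-> k.-tuple R}) : measurable (Z @^-1` (~` D)).
  by rewrite -[X in measurable X]setTI; exact: measurable_funP.
apply: (subset_measure0 _ _ _ (etrans (measureU0 (mpre X) (mpre Y) Y0) X0)).
- rewrite -[X in measurable X]setTI; apply: measurable_edist => //.
- exact: measurableU.
move=> w /=; rewrite in_itv/= andbT => Mlt.
apply/not_andP => -[Dx Dy].
by have := DM _ _ Dx Dy; rewrite leNgt Mlt.
Qed.

End distance_law.

(** * The likelihood equation *)

(** Eventually |g - f| <= f / 2. *)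
Lemma equiv_near_gt0 (R : realType) (F : filter_on R) (f g : R -> R) :
  g ~_F f -> (\forall t \near F, 0 < f t) -> \forall t \near F, 0 < g t.
Proof.
move=> /eqaddoP/(_ 2^-1); rewrite invr_gt0 => /(_ (ltr0Sn _ _)) gf f0.
apply: filterS2 gf f0 => t /=; rewrite !fctE => gf f0.
move: gf; rewrite (gtr0_norm f0) ler_norml => /andP[gf _]; lra.
Qed.

Lemma ball_volume_asymptotics_gt0 (R : realType) (k : nat) : (1 <= k)%N ->
  \forall t \near 0^'+,
    0 < k%:R * pi `^ (k%:R / 2) / Gamma (k%:R / 2 + 1) * t ^+ (k - 1) :> R.
Proof.
move=> k1; near=> t; have t0 : 0 < t by near: t; exact: nbhs_right_gt.
have k0 : 0 < k%:R :> R by rewrite ltr0n.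
rewrite mulr_gt0 ?exprn_gt0// divr_gt0 ?mulr_gt0 ?powR_gt0 ?pi_gt0//.
by rewrite Gamma_gt0// ltrDr divr_gt0.
Unshelve. all: by end_near.
Qed.

Theorem mainTheorem6 (R : realType) (k : nat) (hk : (1 <= k)%N)
  (D : set (k.-tuple R)) (D_meas : measurable D) (D_bounded : ebounded D)
  (D_pos : (0 < volume D)%E)
  (disp : measure_display) (T : measurableType disp) (P : probability T R)
  (X Y : {RV P >-> k.-tuple R})
  (X_unif : uniform_on P D X) (Y_unif : uniform_on P D Y)
  (XY_indep : independent P X Y)
  (g : R -> R)
  (g_density : density_on_pos P (fun w => edist (X w) (Y w)) g)
  (g_near0 : g ~_(0^'+)
     (fun t => k%:R * pi `^ (k%:R / 2) / Gamma (k%:R / 2 + 1) * t ^+ (k - 1))) :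
  [/\ {within `[0, +oo[, continuous (lap_ratio g)},
      forall s, 0 <= s -> 0 < lap_ratio g s,
      forall s t, 0 <= s -> s < t -> lap_ratio g t < lap_ratio g s,
      lap_ratio g 0 = dmax g &
      lap_ratio g s @[s --> +oo] --> 0]
  /\ (forall dbar, 0 < dbar -> dbar <= dmax g ->
        exists! s, 0 <= s /\ derive1 (laplace g) s / laplace g s = - dbar)
  /\ (forall dbar, dmax g < dbar ->
        ~ exists s, 0 <= s /\ derive1 (laplace g) s / laplace g s = - dbar).
Proof.
have [mg g0 gP] := g_density; have [M DM] := D_bounded.
have g1 : (\int[lebesgue_measure]_(t in pos_reals R) (g t)%:E = 1)%E.
  have := gP setT measurableT.
  by rewrite preimage_setT probability_setT setTI => <-.
have intg : lebesgue_measure.-integrable (pos_reals R) (EFin \o g).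
  apply/integrableP; split; first exact/measurable_EFinP.
  apply: (@le_lt_trans _ _ 1%E); last exact: ltry.
  rewrite -g1 le_eqVlt; apply/orP; left; apply/eqP.
  apply: eq_integral => t /set_mem.
  by rewrite in_pos_reals => t0 /=; rewrite ger0_norm// g0.
have g_exp : exp_integrable g.
  apply: (exp_integrable_bounded_support (M := M) intg g0).
  rewrite -gP; first exact: edist_le_ae D_meas DM X_unif Y_unif.
  exact: measurable_itv.
have g_int : \int[lebesgue_measure]_(t in pos_reals R) g t = 1.
  by rewrite /Rintegral g1.
have g_mass : 0 < \int[lebesgue_measure]_(t in pos_reals R) g t.
  by rewrite g_int.
have mass0 : positive_mass_near0 g.
  apply: positive_mass_near0_of_near => //.
  exact: equiv_near_gt0 g_near0 (ball_volume_asymptotics_gt0 R hk).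
have eqE s dbar : derive1 (laplace g) s / laplace g s = - dbar <->
    lap_ratio g s = dbar.
  rewrite /lap_ratio mulNr; split => [->|<-]; first exact: opprK.
  by rewrite opprK.
split; [split|split].
- by apply: continuous_subspaceT; exact: continuous_lap_ratio.
- by move=> s _; exact: lap_ratio_gt0.
- by move=> s t _; exact: lap_ratio_decreasing.
- exact: lap_ratio0.
- exact: lap_ratio_cvg0.
- move=> dbar d0 dle.
  have [s s0 hs] := lap_ratio_surj g0 g_exp g_mass g_int mass0 d0 dle.
  exists s; split; first by split => //; apply/eqE.
  move=> t [t0 /eqE ht]; apply/eqP; rewrite eq_le !leNgt.
  by apply/andP; split; apply/negP => /(lap_ratio_decreasing g0 g_exp g_mass);
    rewrite hs ht ltxx.
- move=> dbar dlt [s [s0 /eqE hs]].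
  have := lap_ratio_le_dmax g0 g_exp g_mass g_int s0.
  by rewrite hs leNgt dlt.
Qed.
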